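(* Every category of interest in the sense of Orzech is algebraically coherent.
   Context: A cospan $(f\colon X\to Z,\ g\colon Y\to Z)$ is jointly strongly epimorphic if for every monomorphism $m\colon M\to P$ and all morphisms $\phi\colon Z\to P$, $f'\colon X\to M$, $g'\colon Y\to M$ with $\phi f=mf'$ and $\phi g=mg'$ there is a unique $\varphi\colon Z\to M$ with $m\varphi=\phi$. (In a category with pullbacks this is equivalent to: every monomorphism into $Z$ through which both $f$ and $g$ factor is an isomorphism.) A functor between categories with finite limits is coherent if it preserves finite limits and jointly strongly epimorphic pairs. For an object $X$ of a category $\mathcal{C}$, $\mathsf{Pt}_X(\mathcal{C})$ is the category of points over $X$: objects are triples $(A,\ p\colon A\to X,\ s\colon X\to A)$ with $ps=1_X$, and morphisms are morphisms of $\mathcal{C}$ between the total objects $A$ commuting with the $p$'s and the $s$'s. For $f\colon X\to Y$, the change-of-base functor $f^*\colon \mathsf{Pt}_Y(\mathcal{C})\to\mathsf{Pt}_X(\mathcal{C})$ is given by pulling back along $f$. A category $\mathcal{C}$ with finite limits is algebraically coherent if for every morphism $f\colon X\to Y$ in $\mathcal{C}$ the functor $f^*\colon \mathsf{Pt}_Y(\mathcal{C})\to\mathsf{Pt}_X(\mathcal{C})$ is coherent. A category of interest is a variety of universal algebras (with homomorphisms) whose theory contains a unique constant $0$, a set $\Omega$ of finitary operations and a set of identities $\mathbb{E}$ such that: (1) $\Omega=\Omega_0\cup\Omega_1\cup\Omega_2$, where $\Omega_i$ is the set of $i$-ary operations; (2) $\Omega_0=\{0\}$, $-\in\Omega_1$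 and $+\in\Omega_2$, and $\mathbb{E}$ includes the group laws for $0$, $-$, $+$ (the group need not be commutative); put $\Omega_1'=\Omega_1\setminus\{-\}$, $\Omega_2'=\Omega_2\setminus\{+\}$; (3) for any $*\in\Omega_2'$, the set $\Omega_2'$ contains $*^{\mathrm{op}}$ defined by $x*^{\mathrm{op}}y=y*x$; (4) for any $\omega\in\Omega_1'$, $\mathbb{E}$ includes the identity $\omega(x+y)=\omega(x)+\omega(y)$; (5) for any $*\in\Omega_2'$, $\mathbb{E}$ includes the identity $x*(y+z)=x*y+x*z$; (6) for any $\omega\in\Omega_1'$ and $*\in\Omega_2'$, $\mathbb{E}$ includes the identity $\omega(x)*y=\omega(x*y)$; (7) for any $*\in\Omega_2'$, $\mathbb{E}$ includes the identity $x+(y*z)=(y*z)+x$; (8) for any $*,\circ\in\Omega_2'$ there exists a word $w$ such that $\mathbb{E}$ includes the identity $$(x*y)\circ z=w\bigl(x*_1(y\circ_1 z),\ldots,x*_m(y\circ_m z),\,y*_{m+1}(x\circ_{m+1}z),\ldots,y*_n(x\circ_n z)\bigr)$$ where $*_1,\ldots,*_n$ and $\circ_1,\ldots,\circ_n$ are operations in $\Omega_2'$. *)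

(* Defs.v *)
From mathcomp Require Import all_boot.
From mathcomp Require Import boolp classical_sets cardinality.

Set Implicit Arguments.
Unset Strict Implicit.
Unset Printing Implicit Defensive.

Declare Scope cat_scope.
Delimit Scope cat_scope with cat.
Local Open Scope cat_scope.

Record category := Category {
  obj :> Type;
  hom : obj -> obj -> Type;
  idm : forall a, hom a a;
  comp : forall a b c, hom b c -> hom a b -> hom a c;
  comp_idl : forall a b (f : hom a b), comp (idm b) f = f;
  comp_idr : forall a b (f : hom a b), comp f (idm a) = f;
  comp_assoc : forall a b c d (h : hom c d) (g : hom b c) (f : hom a b),
    comp h (comp g f) = comp (comp h g) f }.

Arguments hom {_} a b.
Arguments idm {_} a.
Arguments comp {_ a b c} _ _.

Notation "g ∘ f" := (comp g f) (at level 40, left associativity) : cat_scope.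

Record functor (C D : category) := Functor {
  fobj :> C -> D;
  fmap : forall a b : C, hom a b -> hom (fobj a) (fobj b);
  fmap_id : forall a : C, fmap (idm a) = idm (fobj a);
  fmap_comp : forall (a b c : C) (g : hom b c) (f : hom a b),
    fmap (g ∘ f) = fmap g ∘ fmap f }.

Arguments fmap {_ _} _ {_ _} _.

Section FunctorComp.
Variables (J C D : category) (F : functor C D) (G : functor J C).

Lemma functor_comp_id (a : J) : fmap F (fmap G (idm a)) = idm (F (G a)).
Proof. by rewrite !fmap_id. Qed.

Lemma functor_comp_comp (a b c : J) (g : hom b c) (f : hom a b) :
  fmap F (fmap G (g ∘ f)) = fmap F (fmap G g) ∘ fmap F (fmap G f).
Proof. by rewrite !fmap_comp. Qed.

Definition functor_comp : functor J D :=
  Functor functor_comp_id functor_comp_comp.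

End FunctorComp.

Record cone (J C : category) (D : functor J C) := Cone {
  apex : C;
  leg : forall j : J, hom apex (D j);
  leg_natural : forall (i j : J) (u : hom i j), fmap D u ∘ leg i = leg j }.

Definition is_limit (J C : category) (D : functor J C) (K : cone D) : Prop :=
  forall L : cone D,
    exists! h : hom (apex L) (apex K), forall j : J, leg K j ∘ h = leg L j.

Lemma map_cone_natural (J C C' : category) (F : functor C C')
    (D : functor J C) (K : cone D) (i j : J) (u : hom i j) :
  fmap (functor_comp F D) u ∘ fmap F (leg K i) = fmap F (leg K j).
Proof. by rewrite -fmap_comp leg_natural. Qed.

Definition map_cone (J C C' : category) (F : functor C C')
    (D : functor J C) (K : cone D) : cone (functor_comp F D) :=
  @Cone J C' (functor_comp F D) (F (apex K)) (fun j => fmap F (leg K j))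
    (map_cone_natural F K).

Definition finite_category (J : category) : Prop :=
  finite_set [set: J]%classic /\
  forall i j : J, finite_set [set: hom i j]%classic.

Definition has_finite_limits (C : category) : Prop :=
  forall J : category, finite_category J ->
  forall D : functor J C, exists K : cone D, is_limit K.

Definition preserves_finite_limits (C D : category) (F : functor C D) : Prop :=
  forall J : category, finite_category J ->
  forall (G : functor J C) (K : cone G), is_limit K -> is_limit (map_cone F K).

Definition monic (C : category) (M P : C) (m : hom M P) : Prop :=
  forall (W : C) (u v : hom W M), m ∘ u = m ∘ v -> u = v.

Definition jointly_strongly_epic (C : category) (X Y Z : C)
    (f : hom X Z) (g : hom Y Z) : Prop :=
  forall (M P : C) (m : hom M P), monic m ->
  forall (phi : hom Z P) (f' : hom X M) (g' : hom Y M),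
    phi ∘ f = m ∘ f' -> phi ∘ g = m ∘ g' ->
    exists! psi : hom Z M, m ∘ psi = phi.

Definition preserves_jointly_strongly_epic (C D : category)
    (F : functor C D) : Prop :=
  forall (X Y Z : C) (f : hom X Z) (g : hom Y Z),
    jointly_strongly_epic f g -> jointly_strongly_epic (fmap F f) (fmap F g).

Record coherent (C D : category) (F : functor C D) : Prop := Coherent {
  coherent_dom : has_finite_limits C;
  coherent_cod : has_finite_limits D;
  coherent_lim : preserves_finite_limits F;
  coherent_jse : preserves_jointly_strongly_epic F }.

(* The mediating morphism is part of the data, so that pulling back is a
   function on morphisms and not only a relation. *)
Record pullback (C : category) (X Y Z : C) (f : hom X Z) (g : hom Y Z) :=
  Pullback {
    pb : C;
    pb1 : hom pb X;
    pb2 : hom pb Y;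
    pb_comm : f ∘ pb1 = g ∘ pb2;
    pb_pair : forall (W : C) (u : hom W X) (v : hom W Y),
      f ∘ u = g ∘ v -> hom W pb;
    pb_pair1 : forall W (u : hom W X) (v : hom W Y) (e : f ∘ u = g ∘ v),
      pb1 ∘ pb_pair e = u;
    pb_pair2 : forall W (u : hom W X) (v : hom W Y) (e : f ∘ u = g ∘ v),
      pb2 ∘ pb_pair e = v;
    pb_uniq : forall W (h k : hom W pb),
      pb1 ∘ h = pb1 ∘ k -> pb2 ∘ h = pb2 ∘ k -> h = k }.

Definition pullback_choice (C : category) : Type :=
  forall (X Y Z : C) (f : hom X Z) (g : hom Y Z), pullback f g.

(* [algebraically_coherent] below quantifies over all choices of pullbacks;
   [has_finite_limits_pullbacks] shows that this is never vacuous. *)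
Section FiniteLimitsPullbacks.

(* The shape Some true -> None <- Some false. *)
Let cospan_hom (i j : option bool) : Type :=
  {_ : unit | (j == i) || (j == None)}.

Let cospan_id i : cospan_hom i i.
Proof. by exists tt; rewrite eqxx. Defined.

Let cospan_comp i j k : cospan_hom j k -> cospan_hom i j -> cospan_hom i k.
Proof.
by case=> _ jk [_ ij]; exists tt; case: i j k ij jk => [[]|] [[]|] [[]|].
Defined.

Let cospan_hom_eq i j (u v : cospan_hom i j) : u = v.
Proof. by apply: val_inj; case: (val u) (val v) => -[]. Qed.

Let cospan : category :=
  @Category (option bool) cospan_hom cospan_id cospan_comp
    (fun _ _ _ => cospan_hom_eq _ _) (fun _ _ _ => cospan_hom_eq _ _)
    (fun _ _ _ _ _ _ _ => cospan_hom_eq _ _).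

Let cospan_finite : finite_category cospan.
Proof.
split=> [|i j]; first exact: (@finite_finset (option bool)).
exact: (@finite_finset {_ : unit | (j == i) || (j == None)}).
Qed.

Lemma has_finite_limits_pullbacks (C : category) :
  has_finite_limits C -> inhabited (pullback_choice C).
Proof.
move=> limC.
suff pbC (X Y Z : C) (f : hom X Z) (g : hom Y Z) : inhabited (pullback f g).
  split=> X Y Z f g.
  by have /cid [] : exists _ : pullback f g, True; [case: (pbC _ _ _ f g); exists|].
pose ob i := match i with Some true => X | Some false => Y | None => Z end.
pose mor (i j : option bool) : cospan_hom i j -> hom (ob i) (ob j) :=
  match i, j return cospan_hom i j -> hom (ob i) (ob j) with
  | Some true, Some true => fun=> idm X
  | Some false, Some false => fun=> idm Y
  | None, None => fun=> idm Z
  | Some true, None => fun=> f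
  | Some false, None => fun=> g
  | Some true, Some false => fun u => False_rect _ (notF (valP u))
  | Some false, Some true => fun u => False_rect _ (notF (valP u))
  | None, Some true => fun u => False_rect _ (notF (valP u))
  | None, Some false => fun u => False_rect _ (notF (valP u))
  end.
have mor_id i : mor i i (cospan_id i) = idm (ob i) by case: i => [[]|].
have mor_comp i j k (v : cospan_hom j k) (u : cospan_hom i j) :
    mor i k (cospan_comp v u) = mor j k v ∘ mor i j u.
  case: i j k u v => [[]|] [[]|] [[]|] u v //=;
    by [case: (notF (valP u)) | case: (notF (valP v))
       | rewrite ?comp_idl ?comp_idr].
pose D : functor cospan C := @Functor cospan C ob mor mor_id mor_comp.
have [K limK] := limC _ cospan_finite D.
pose ut : cospan_hom (Some true) None := exist _ tt isT.
pose uf : cospan_hom (Some false) None := exist _ tt isT.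
have Kt : f ∘ leg K (Some true) = leg K None :=
  @leg_natural cospan C D K (Some true) None ut.
have Kf : g ∘ leg K (Some false) = leg K None :=
  @leg_natural cospan C D K (Some false) None uf.
have pairK W (u : hom W X) (v : hom W Y) : f ∘ u = g ∘ v ->
    exists! h : hom W (apex K),
      leg K (Some true) ∘ h = u /\ leg K (Some false) ∘ h = v.
  move=> e.
  pose l (i : cospan) : hom W (D i) :=
    match i return hom W (ob i) with
    | Some true => u | Some false => v | None => f ∘ u end.
  have l_nat (i j : cospan) (w : hom i j) : fmap D w ∘ l i = l j.
    by case: i j w => [[]|] [[]|] w //=;
      [rewrite comp_idl | case: (notF (valP w)) | case: (notF (valP w))
      | rewrite comp_idl | case: (notF (valP w)) | case: (notF (valP w))
      | rewrite comp_idl].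
  have [h [hl hu]] := limK (Cone l_nat).
  exists h; split=> [|k [k1 k2]]; first by split; [exact: (hl (Some true))|exact: (hl (Some false))].
  apply: hu => -[[]|] //=; by rewrite -Kt -comp_assoc k1.
constructor.
apply: (@Pullback C X Y Z f g (apex K) (leg K (Some true)) (leg K (Some false))
  (etrans Kt (esym Kf)) (fun W u v e => sval (cid (pairK W u v e)))).
- by move=> W u v e; case: cid => h /= [[]].
- by move=> W u v e; case: cid => h /= [[]].
- move=> W h k e1 e2.
  have [|x [_ xu]] := pairK W (leg K (Some true) ∘ h) (leg K (Some false) ∘ h).
    by rewrite !comp_assoc Kt Kf.
  by rewrite -(xu h) // -(xu k).
Qed.

End FiniteLimitsPullbacks.

Section Points.
Variables (C : category) (X : C).

Record point := Point {
  pt_obj : C;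
  pt_p : hom pt_obj X;
  pt_s : hom X pt_obj;
  pt_ps : pt_p ∘ pt_s = idm X }.

Record point_hom (A B : point) := PointHom {
  pt_map : hom (pt_obj A) (pt_obj B);
  pt_map_p : pt_p B ∘ pt_map = pt_p A;
  pt_map_s : pt_map ∘ pt_s A = pt_s B }.

Lemma point_hom_eq (A B : point) (f g : point_hom A B) :
  pt_map f = pt_map g -> f = g.
Proof.
case: f g => f fp fs [g gp gs] /= e; move: fp fs; rewrite e => fp fs.
by congr PointHom; exact: Prop_irrelevance.
Qed.

Definition point_id (A : point) : point_hom A A :=
  PointHom (comp_idr (pt_p A)) (comp_idl (pt_s A)).

Section PointComp.
Variables (A B D : point) (g : point_hom B D) (f : point_hom A B).

Lemma point_comp_p : pt_p D ∘ (pt_map g ∘ pt_map f) = pt_p A.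
Proof. by rewrite comp_assoc !pt_map_p. Qed.

Lemma point_comp_s : (pt_map g ∘ pt_map f) ∘ pt_s A = pt_s D.
Proof. by rewrite -comp_assoc !pt_map_s. Qed.

Definition point_comp : point_hom A D := PointHom point_comp_p point_comp_s.

End PointComp.

Lemma point_comp_idl (A B : point) (f : point_hom A B) :
  point_comp (point_id B) f = f.
Proof. by apply: point_hom_eq; exact: comp_idl. Qed.

Lemma point_comp_idr (A B : point) (f : point_hom A B) :
  point_comp f (point_id A) = f.
Proof. by apply: point_hom_eq; exact: comp_idr. Qed.

Lemma point_comp_assoc (A B D E : point) (h : point_hom D E)
    (g : point_hom B D) (f : point_hom A B) :
  point_comp h (point_comp g f) = point_comp (point_comp h g) f.
Proof. by apply: point_hom_eq; exact: comp_assoc. Qed.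

Definition Pt : category :=
  Category point_comp_idl point_comp_idr point_comp_assoc.

End Points.

Section ChangeOfBase.
Variables (C : category) (P : pullback_choice C) (X Y : C) (f : hom X Y).

Section OnObjects.
Variable A : Pt Y.

Lemma cob_s_comm : f ∘ idm X = pt_p A ∘ (pt_s A ∘ f).
Proof. by rewrite comp_idr comp_assoc pt_ps comp_idl. Qed.

Definition cob_obj : Pt X :=
  Point (pb_pair1 (P f (pt_p A)) cob_s_comm).

End OnObjects.

Section OnMorphisms.
Variables (A B : Pt Y) (h : hom A B).

Lemma cob_map_comm :
  f ∘ pb1 (P f (pt_p A)) = pt_p B ∘ (pt_map h ∘ pb2 (P f (pt_p A))).
Proof. by rewrite pb_comm comp_assoc pt_map_p. Qed.

Definition cob_map : hom (pt_obj (cob_obj A)) (pt_obj (cob_obj B)) :=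
  pb_pair (P f (pt_p B)) cob_map_comm.

Lemma cob_map_p : pt_p (cob_obj B) ∘ cob_map = pt_p (cob_obj A).
Proof. exact: pb_pair1. Qed.

Lemma cob_map_s : cob_map ∘ pt_s (cob_obj A) = pt_s (cob_obj B).
Proof.
apply: pb_uniq; rewrite comp_assoc ?pb_pair1 ?pb_pair2 //.
by rewrite -comp_assoc pb_pair2 comp_assoc pt_map_s.
Qed.

Definition cob_hom : hom (cob_obj A) (cob_obj B) := PointHom cob_map_p cob_map_s.

End OnMorphisms.

Lemma cob_id (A : Pt Y) : cob_hom (idm A) = idm (cob_obj A).
Proof.
apply: point_hom_eq; apply: pb_uniq; rewrite ?pb_pair1 ?pb_pair2 comp_idr //.
exact: comp_idl.
Qed.

Lemma cob_comp (A B D : Pt Y) (g : hom B D) (h : hom A B) :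
  cob_hom (g ∘ h) = cob_hom g ∘ cob_hom h.
Proof.
apply: point_hom_eq; apply: pb_uniq; rewrite comp_assoc ?pb_pair1 ?pb_pair2 //.
by rewrite -[RHS]comp_assoc pb_pair2 comp_assoc.
Qed.

Definition change_of_base : functor (Pt Y) (Pt X) := Functor cob_id cob_comp.

End ChangeOfBase.

Definition algebraically_coherent (C : category) : Prop :=
  has_finite_limits C /\
  forall (P : pullback_choice C) (X Y : C) (f : hom X Y),
    coherent (change_of_base P f).

(* [S n] is the set of n-ary operation symbols. *)
Definition signature := nat -> Type.

Section Varieties.
Variable S : signature.

Inductive term (V : Type) : Type :=
| Var of V
| Op n of S n & ('I_n -> term V).

Fixpoint subst (V W : Type) (s : V -> term W) (t : term V) : term W :=
  match t with
  | Var x => s x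
  | Op _ o a => Op o (fun i => subst s (a i))
  end.

Record algebra := Algebra {
  carrier :> Type;
  op : forall n, S n -> ('I_n -> carrier) -> carrier }.

Fixpoint eval (A : algebra) (V : Type) (v : V -> A) (t : term V) : A :=
  match t with
  | Var x => v x
  | Op _ o a => op o (fun i => eval v (a i))
  end.

Definition satisfies (A : algebra) (s t : term nat) : Prop :=
  forall v : nat -> A, eval v s = eval v t.

Definition identities := term nat -> term nat -> Prop.

Variable E : identities.

Definition is_model (A : algebra) : Prop :=
  forall s t, E s t -> satisfies A s t.

Record model := Model {
  model_algebra :> algebra;
  modelP : is_model model_algebra }.

Record alg_hom (A B : algebra) := AlgHom {
  alg_fun :> A -> B;
  alg_funP : forall n (o : S n) (a : 'I_n -> A),
    alg_fun (op o a) = op o (fun i => alg_fun (a i)) }.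

Lemma alg_hom_eq (A B : algebra) (f g : alg_hom A B) : f =1 g -> f = g.
Proof.
case: f g => f fP [g gP] /= /funext e; move: fP; rewrite e => fP.
by congr AlgHom; exact: Prop_irrelevance.
Qed.

Definition alg_id (A : algebra) : alg_hom A A :=
  @AlgHom A A id (fun _ _ _ => erefl).

Lemma alg_compP (A B D : algebra) (g : alg_hom B D) (f : alg_hom A B)
    n (o : S n) (a : 'I_n -> A) :
  g (f (op o a)) = op o (fun i => g (f (a i))).
Proof. by rewrite !alg_funP. Qed.

Definition alg_comp (A B D : algebra) (g : alg_hom B D) (f : alg_hom A B) :
    alg_hom A D :=
  @AlgHom A D (fun x => g (f x)) (alg_compP g f).

Lemma alg_comp_idl (A B : model) (f : alg_hom A B) : alg_comp (alg_id B) f = f.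
Proof. exact: alg_hom_eq. Qed.

Lemma alg_comp_idr (A B : model) (f : alg_hom A B) : alg_comp f (alg_id A) = f.
Proof. exact: alg_hom_eq. Qed.

Lemma alg_comp_assoc (A B D G : model) (h : alg_hom D G) (g : alg_hom B D)
    (f : alg_hom A B) :
  alg_comp h (alg_comp g f) = alg_comp (alg_comp h g) f.
Proof. exact: alg_hom_eq. Qed.

Definition variety : category :=
  @Category model (fun A B => alg_hom A B) (fun A => alg_id A)
    (fun _ _ _ g f => alg_comp g f)
    alg_comp_idl alg_comp_idr alg_comp_assoc.

(* "The theory includes the identity s = t": s = t is a consequence of E.
   In particular this holds when the pair (s, t) belongs to E. *)
Definition includes (s t : term nat) : Prop :=
  forall A : algebra, is_model A -> satisfies A s t.

End Varieties.

Arguments Var {S V} _.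
Arguments Op {S V n} _ _.

Section CategoryOfInterest.
Variable S : signature.

Definition op0 (V : Type) (o : S 0) : term S V :=
  Op o (fun i : 'I_0 => False_rect _ (notF (ltn_ord i))).

Definition op1 (V : Type) (o : S 1) (s : term S V) : term S V :=
  Op o (fun=> s).

Definition op2 (V : Type) (o : S 2) (s t : term S V) : term S V :=
  Op o (fun i : 'I_2 => if i == ord0 then s else t).

Variables (E : identities S) (zero : S 0) (neg : S 1) (plus : S 2).

Declare Scope identity_scope.
Local Notation "0" := (op0 nat zero) : identity_scope.
Local Notation "- s" := (op1 neg s) : identity_scope.
Local Notation "s + t" := (op2 plus s t) : identity_scope.
Local Notation "s ≈ t" := (includes E s t) 
    (at level 70) : identity_scope.
Local Open Scope identity_scope.

Local Notation x := (Var 0%N).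
Local Notation y := (Var 1%N).
Local Notation z := (Var 2%N).

Definition unary' := {o : S 1 | o <> neg}.
Definition binary' := {o : S 2 | o <> plus}.

Local Notation un w s := (op1 (sval w) s).
Local Notation bin b s t := (op2 (sval b) s t).

Record interest_axioms : Prop := InterestAxioms {
  int_arity : forall n, (2 < n)%N -> S n -> False;
  int_zero : forall c : S 0%N, c = zero;
  int_addA : x + (y + z) ≈ (x + y) + z;
  int_add0x : 0 + x ≈ x;
  int_addx0 : x + 0 ≈ x;
  int_addNx : (- x) + x ≈ 0;
  int_addxN : x + (- x) ≈ 0;
  int_op : forall b : binary', exists b' : binary', bin b' x y ≈ bin b y x;
  int_unD : forall w : unary', un w (x + y) ≈ un w x + un w y;
  int_binD : forall b : binary', bin b x (y + z) ≈ bin b x y + bin b x z;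
  int_un_bin : forall (w : unary') (b : binary'),
    bin b (un w x) y ≈ un w (bin b x y);
  int_bin_central : forall b : binary', x + bin b y z ≈ bin b y z + x;
  (* The two families are indexed from 0: the first m arguments of the word w
     are x *_i (y o_i z), the remaining n - m are y *_i (x o_i z). *)
  int_word : forall b c : binary',
    exists (m n : nat) (w : term S 'I_n) (b_ c_ : 'I_n -> binary'),
      (m <= n)%N /\
      bin c (bin b x y) z ≈
        subst (fun i : 'I_n => if (i < m)%N then bin (b_ i) x (bin (c_ i) y z)
                               else bin (b_ i) y (bin (c_ i) x z)) w }.

End CategoryOfInterest.

Definition category_of_interest (S : signature) (E : identities S) : Prop :=
  exists (zero : S 0) (neg : S 1) (plus : S 2), interest_axioms E zero neg plus.

(* Main.v *)
From mathcomp Require Import all_boot.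
From mathcomp Require Import boolp classical_sets cardinality.
Require Import Defs.

(** Let [u : A -> D] and [v : B -> D] be jointly strongly epic points over [Y],
    with projection [p : D -> Y] and section [s : Y -> D].  In a variety this
    says that [D] is generated, as an algebra, by the images of [u] and [v]
    ([jointly_strongly_epic_generating] and its converse), so preservation of
    such pairs by [f^*] is a question about generators.

    The crucial point is that the kernel of [p] is then generated by the parts
    of the two images that lie in it.  Let [L] be the closure of these parts
    under [0], minus, [+] and the further binary operations.  Three facts about
    [L] follow from the axioms of a category of interest:
    - [L] is closed under the other unary operations, because they are additive
      and can be moved inside a product;
    - [L] is stable under conjugation by [s y], because products are central;
    - [L] is stable under multiplication by [s y], because the word axiom
      rewrites [(l * l') o s y] by means of products of an element of [L] with
      some [l o' s y] or [l' o' s y].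
    Hence the elements [l + s y] with [l] in [L] form a subalgebra
    ([span_complement_subalgebra]); it contains the images of [u] and [v], so it
    is all of [D].  The description of [L] does not mention [s]; this matters
    because over [X] only the elements [s (f x)] are available to act, and it is
    why generation survives pulling back.  An element [(x, d)] of [f^* D] is
    [(0, l) + (x, s (f x))], where [(0, l)] is built from elements [(0, k)] in
    the images of [f^* u] and [f^* v], and [(x, s (f x))] is the value at [x]
    of the section of [f^* D] ([change_of_base_generating]).

    As for finite limits, in any category that has them a limit of points over
    [X] is computed as a limit over [X] of the underlying objects
    ([limit_limit_over]), and in this form it is visibly stable under pullback
    ([change_of_base_limits]).  A variety has finite limits since a limit is a
    subalgebra of a product ([variety_finite_limits]). *)

Set Implicit Arguments.
Unset Strict Implicit.
Unset Printing Implicit Defensive.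

Local Open Scope cat_scope.

(** * Limits in categories of points *)

Lemma exists_unique_eq (T : Type) (P : T -> Prop) (x y : T) :
  (exists! z, P z) -> P x -> P y -> x = y.
Proof. by move=> [z [_ zu]] /zu <- /zu. Qed.

Section AddTerminal.
Variable J : category.

Definition add_terminal_hom (i j : option J) : Type :=
  match i, j with
  | _, None => unit
  | Some i, Some j => hom i j
  | None, Some _ => Empty_set
  end.

Definition add_terminal_id i : add_terminal_hom i i :=
  match i with Some i => idm i | None => tt end.

Definition add_terminal_comp i j k :
  add_terminal_hom j k -> add_terminal_hom i j -> add_terminal_hom i k.
Proof.
case: i j k => [i|] [j|] [k|] /=; [exact: comp | exact: (fun _ _ => tt)
  | by [] | exact: (fun _ _ => tt) | by [] | exact: (fun _ _ => tt) | by []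
  | exact: (fun _ _ => tt)].
Defined.

Lemma add_terminal_idl i j (f : add_terminal_hom i j) :
  add_terminal_comp (add_terminal_id j) f = f.
Proof.
by case: i j f => [i|] [j|] //=; [exact: comp_idl | case | case].
Qed.

Lemma add_terminal_idr i j (f : add_terminal_hom i j) :
  add_terminal_comp f (add_terminal_id i) = f.
Proof. by case: i j f => [i|] [j|] //=; [exact: comp_idr | case | case]. Qed.

Lemma add_terminal_assoc i j k l (h : add_terminal_hom k l)
    (g : add_terminal_hom j k) (f : add_terminal_hom i j) :
  add_terminal_comp h (add_terminal_comp g f) =
  add_terminal_comp (add_terminal_comp h g) f.
Proof.
by case: i j k l f g h => [i|] [j|] [k|] [l|] //= f g h; exact: comp_assoc.
Qed.

Definition add_terminal : category :=
  Category add_terminal_idl add_terminal_idr add_terminal_assoc.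

Lemma add_terminal_finite : finite_category J -> finite_category add_terminal.
Proof.
move=> [finJ finH]; split.
  have -> : [set: add_terminal]%classic =
      (Some @` [set: J] `|` [set None])%classic.
    by apply/seteqP; split=> // -[j|] _; [left; exists j | right].
  by rewrite finite_setU; split; [exact: finite_image | exact: finite_set1].
move=> [i|] [j|] /=; first exact: finH.
- exact: (@finite_finset unit).
- suff -> : [set: Empty_set]%classic = set0 by exact: finite_set0.
  by apply/seteqP; split=> -[].
- exact: (@finite_finset unit).
Qed.

End AddTerminal.

Section LimitsOfPoints.
Variables (C : category) (X : C).

(** The universal property of a limit in the slice category over [X], where the
    competing objects need not carry a section. *)
Definition limit_over (J : category) (D : functor J (Pt X)) (K : cone D) :
    Prop :=
  forall (W : C) (q : hom W X) (w : forall j, hom W (pt_obj (D j))),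
    (forall j, pt_p (D j) ∘ w j = q) ->
    (forall i j (u : hom i j), pt_map (fmap D u) ∘ w i = w j) ->
    exists! h : hom W (pt_obj (apex K)),
      pt_p (apex K) ∘ h = q /\ forall j, pt_map (leg K j) ∘ h = w j.

(** A limit in the slice over [X] is a limit in [C] of the diagram extended by
    [X] as a new terminal vertex.  The sections of the [D j] induce its
    section. *)
Lemma limit_over_exists (J : category) (D : functor J (Pt X)) :
  has_finite_limits C -> finite_category J ->
  exists K : cone D, limit_over K.
Proof.
move=> limC finJ.
pose ob (i : option J) := if i is Some i then pt_obj (D i) else X.
pose mor (i j : option J) : add_terminal_hom i j -> hom (ob i) (ob j) :=
  match i, j return add_terminal_hom i j -> hom (ob i) (ob j) with
  | Some i, Some j => fun u => pt_map (fmap D u)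
  | Some i, None => fun=> pt_p (D i)
  | None, None => fun=> idm X
  | None, Some _ => fun u => match u with end
  end.
have mor_id i : mor i i (add_terminal_id i) = idm (ob i).
  by case: i => [i|] //=; rewrite fmap_id.
have mor_comp i j k (v : add_terminal_hom j k) (u : add_terminal_hom i j) :
    mor i k (add_terminal_comp v u) = mor j k v ∘ mor i j u.
  case: i j k u v => [i|] [j|] [k|] //= u v; rewrite ?comp_idl //.
  - by rewrite fmap_comp.
  - by rewrite (pt_map_p (fmap D u)).
pose DX : functor (add_terminal J) C :=
  @Functor (add_terminal J) C ob mor mor_id mor_comp.
have [K0 limK0] := limC _ (add_terminal_finite finJ) DX.
have K0_univ W (q : hom W X) (w : forall j, hom W (pt_obj (D j))) :
    (forall j, pt_p (D j) ∘ w j = q) ->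
    (forall i j (u : hom i j), pt_map (fmap D u) ∘ w i = w j) ->
    exists! h : hom W (apex K0),
      leg K0 None ∘ h = q /\ forall j, leg K0 (Some j) ∘ h = w j.
  move=> pw wn.
  pose l (i : add_terminal J) : hom W (DX i) :=
    match i return hom W (ob i) with Some j => w j | None => q end.
  have l_nat (i j : add_terminal J) (u : hom i j) : fmap DX u ∘ l i = l j.
    case: i j u => [i|] [j|] u /=; [exact: wn | exact: pw | by case: u
      | exact: comp_idl].
  have [h [hl hu]] := limK0 (Cone l_nat).
  exists h; split=> [|k [k1 k2]]; last by apply: hu => -[].
  by split=> [|j]; [exact: (hl None) | exact: (hl (Some j))].
have legN j : pt_p (D j) ∘ leg K0 (Some j) = leg K0 None :=
  @leg_natural _ _ _ K0 (Some j) None tt.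
have legS i j (u : hom i j) :
    pt_map (fmap D u) ∘ leg K0 (Some i) = leg K0 (Some j) :=
  @leg_natural _ _ _ K0 (Some i) (Some j) u.
have [s [[s1 s2] _]] := K0_univ X (idm X) (fun j => pt_s (D j))
  (fun j => pt_ps (D j)) (fun i j u => pt_map_s (fmap D u)).
pose A : Pt X := Point s1.
pose l j : hom A (D j) := @PointHom C X A (D j) (leg K0 (Some j)) (legN j) (s2 j).
have l_nat i j (u : hom i j) : fmap D u ∘ l i = l j.
  by apply: point_hom_eq; exact: legS.
by exists (Cone l_nat).
Qed.

(** The mediating morphism over [X] automatically respects the sections, both
    composites with them being induced by the cone of the sections of [D]. *)
Lemma limit_over_limit (J : category) (D : functor J (Pt X)) (K : cone D) :
  limit_over K -> is_limit K.
Proof.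
move=> overK L.
have [|i j u|h [[hp hl] hu]] := overK _ (pt_p (apex L))
    (fun j => pt_map (leg L j)).
- by move=> j; exact: pt_map_p.
- by rewrite -(leg_natural L u).
have hs : h ∘ pt_s (apex L) = pt_s (apex K).
  apply: (exists_unique_eq (overK X (idm X) (fun j => pt_s (D j)) _ _)).
  - by move=> j; exact: pt_ps.
  - by move=> i j u; exact: pt_map_s.
  - split=> [|j]; first by rewrite comp_assoc hp pt_ps.
    by rewrite comp_assoc hl pt_map_s.
  - split=> [|j]; [exact: pt_ps | exact: pt_map_s].
exists (PointHom hp hs); split=> [j|k kl]; first exact/point_hom_eq/hl.
apply: point_hom_eq; apply: hu; split=> [|j]; first exact: pt_map_p.
by rewrite -kl.
Qed.

(** The converse holds by uniqueness of limits: some limit has the stronger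
    property, and any other one is isomorphic to it. *)
Lemma limit_limit_over (J : category) (D : functor J (Pt X)) (K : cone D) :
  has_finite_limits C -> finite_category J -> is_limit K -> limit_over K.
Proof.
move=> limC finJ limK W q w wp wn.
have [K' overK'] := limit_over_exists D limC finJ.
have [h [hl _]] := limK K'.
have [k [kl _]] := limit_over_limit overK' K.
have hk : h ∘ k = idm (apex K).
  apply: (exists_unique_eq (limK K)) => j; last exact: comp_idr.
  by rewrite comp_assoc hl kl.
have [t [[tp tl] tu]] := overK' W q w wp wn.
exists (pt_map h ∘ t); split=> [|r [rp rl]].
  split=> [|j]; first by rewrite comp_assoc pt_map_p.
  by rewrite comp_assoc -tl -hl.
rewrite (tu (pt_map k ∘ r)); last first.
  split=> [|j]; first by rewrite comp_assoc pt_map_p.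
  by rewrite comp_assoc -rl -kl.
by rewrite comp_assoc -[pt_map h ∘ pt_map k]/(pt_map (h ∘ k)) hk comp_idl.
Qed.

Lemma Pt_finite_limits : has_finite_limits C -> has_finite_limits (Pt X).
Proof.
move=> limC J finJ D; have [K overK] := limit_over_exists D limC finJ.
by exists K; exact: limit_over_limit.
Qed.

(** The kernel pair of a morphism of points is again a point, so that the
    forgetful functor to [C] preserves monomorphisms. *)
Lemma point_monic (P : pullback_choice C) (M N : Pt X) (m : hom M N) :
  monic m -> monic (pt_map m).
Proof.
move=> mono_m W u v muv.
pose Q := P _ _ _ (pt_map m) (pt_map m).
pose s : hom X (pb Q) := pb_pair Q (erefl (pt_map m ∘ pt_s M)).
have ps : (pt_p M ∘ pb1 Q) ∘ s = idm X by rewrite -comp_assoc pb_pair1 pt_ps.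
have e2 : pt_p M ∘ pb2 Q = pt_p M ∘ pb1 Q.
  by rewrite -(pt_map_p m) -!comp_assoc pb_comm.
pose R : Pt X := Point ps.
pose r1 : hom R M := @PointHom C X R M (pb1 Q) erefl (pb_pair1 _ _).
pose r2 : hom R M := @PointHom C X R M (pb2 Q) e2 (pb_pair2 _ _).
have r12 : r1 = r2 by apply: mono_m; apply: point_hom_eq; exact: pb_comm.
rewrite -(pb_pair1 Q muv) -{2}(pb_pair2 Q muv).
by rewrite -[pb1 Q]/(pt_map r1) r12.
Qed.

End LimitsOfPoints.

(** A cone over the pulled back diagram is a cone over [G] in the slice over
    [Y], whose vertex has no section over [Y]; hence the need for
    [limit_over]. *)
Lemma change_of_base_limits (C : category) (P : pullback_choice C) (X Y : C)
    (f : hom X Y) :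
  has_finite_limits C -> preserves_finite_limits (change_of_base P f).
Proof.
move=> limC J finJ G K limK; have overK := limit_limit_over limC finJ limK.
move=> L; set pL := pt_p (apex L).
pose pr (A : Pt Y) := pb2 (P _ _ _ f (pt_p A)).
have prE (A B : Pt Y) (u : hom A B) :
    pr B ∘ pt_map (cob_hom P f u) = pt_map u ∘ pr A.
  exact: pb_pair2.
have pr_s (A : Pt Y) : pr A ∘ pt_s (cob_obj P f A) = pt_s A ∘ f.
  exact: pb_pair2.
have legp (j : J) : pt_p (G j) ∘ (pr (G j) ∘ pt_map (leg L j)) = f ∘ pL.
  by rewrite comp_assoc -pb_comm -comp_assoc (pt_map_p (leg L j)).
have [i j u|h [[hp hl] hu]] := overK _ (f ∘ pL) _ legp.
  by rewrite comp_assoc -prE -comp_assoc -(leg_natural L u).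
have hs : h ∘ pt_s (apex L) = pt_s (apex K) ∘ f.
  apply: (exists_unique_eq (overK X f (fun j => pt_s (G j) ∘ f) _ _)).
  - by move=> j; rewrite comp_assoc pt_ps comp_idl.
  - by move=> i j u; rewrite comp_assoc pt_map_s.
  - split=> [|j]; first by rewrite comp_assoc hp -comp_assoc pt_ps comp_idr.
    rewrite comp_assoc hl -comp_assoc (pt_map_s (leg L j)); exact: pr_s.
  - split=> [|j]; first by rewrite comp_assoc pt_ps comp_idl.
    by rewrite comp_assoc pt_map_s.
have gc : f ∘ pL = pt_p (apex K) ∘ h by [].
pose g := pb_pair (P _ _ _ f (pt_p (apex K))) gc.
have gp : pt_p (cob_obj P f (apex K)) ∘ g = pL by exact: pb_pair1.
have gs : g ∘ pt_s (apex L) = pt_s (cob_obj P f (apex K)).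
  apply: pb_uniq; rewrite comp_assoc ?pb_pair1 ?pb_pair2 //; exact: pt_ps.
exists (PointHom gp gs); split=> [j|k kl]; apply: point_hom_eq; apply: pb_uniq.
- by rewrite [RHS](pt_map_p (leg L j)) [LHS]comp_assoc pb_pair1 [LHS]gp.
- by rewrite [LHS]comp_assoc pb_pair2 -comp_assoc pb_pair2 [LHS]hl.
- by rewrite [LHS]gp (pt_map_p k).
- rewrite [LHS]pb_pair2; apply: hu; split=> [|j].
    by rewrite comp_assoc -pb_comm -comp_assoc (pt_map_p k).
  by rewrite comp_assoc -prE -comp_assoc -kl.
Qed.

(** * Subalgebras, products and limits in a variety *)

Section Varieties.
Variables (S : signature) (E : identities S).

Definition subalgebra (A : algebra S) (P : A -> Prop) : Prop :=
  forall n (o : S n) (a : 'I_n -> A), (forall i, P (a i)) -> P (op o a).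

Lemma subalgebra_eval (A : algebra S) (P : A -> Prop) (V : Type) (v : V -> A)
    (t : term S V) :
  subalgebra P -> (forall x, P (v x)) -> P (eval v t).
Proof. by move=> subP Pv; elim: t => [x|n o a IHa] //=; exact: subP. Qed.

Section Subalgebra.
Variables (A : model E) (P : A -> Prop) (subP : subalgebra P).

Definition sub_algebra : algebra S :=
  @Algebra S {x : A | P x}
    (fun n o a => exist P (op o (fun i => sval (a i)))
                          (subP o (fun i => svalP (a i)))).

Lemma sub_inj (x y : sub_algebra) : sval x = sval y -> x = y.
Proof. by case: x y => x Px [y Py] /= exy; exact: eq_exist. Qed.

Lemma sub_eval (V : Type) (v : V -> sub_algebra) (t : term S V) :
  sval (eval v t) = eval (fun x => sval (v x)) t.
Proof.
by elim: t => [x|n o a IHa] //=; congr op; apply: funext => i; exact: IHa.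
Qed.

Lemma sub_algebraP : is_model E sub_algebra.
Proof.
move=> s t Est v; apply: sub_inj; rewrite !sub_eval; exact: (modelP Est).
Qed.

Definition sub_model : variety E := Model sub_algebraP.

Definition sub_incl : hom sub_model A :=
  @AlgHom S sub_algebra A (fun x => sval x) (fun _ _ _ => erefl).

Lemma sub_incl_monic : monic sub_incl.
Proof.
move=> W u v uv; apply: alg_hom_eq => x; apply: sub_inj.
exact: (congr1 (fun h : alg_hom _ _ => h x) uv).
Qed.

Definition sub_lift (B : variety E) (h : alg_hom B A) (Ph : forall x, P (h x)) :
  hom B sub_model.
Proof.
exists (fun x => exist P (h x) (Ph x)) => n o a.
by apply: sub_inj; exact: alg_funP.
Defined.

End Subalgebra.

Section Product.
(* An index type in [Set] keeps the product in the universe of its factors. *)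
Variables (I : Set) (A : I -> model E).

Definition prod_algebra : algebra S :=
  @Algebra S (forall i, A i) (fun n o a i => op o (fun k => a k i)).

Lemma prod_eval (V : Type) (v : V -> prod_algebra) (t : term S V) i :
  eval v t i = eval (fun x => v x i) t.
Proof.
by elim: t => [x|n o a IHa] //=; congr op; apply: funext => k; exact: IHa.
Qed.

Lemma prod_algebraP : is_model E prod_algebra.
Proof.
move=> s t Est v; apply: functional_extensionality_dep => i.
by rewrite !prod_eval; exact: (modelP Est).
Qed.

Definition prod_model : model E := Model prod_algebraP.

Definition prod_proj i : alg_hom prod_model (A i) :=
  @AlgHom S prod_algebra (A i) (fun x => x i) (fun _ _ _ => erefl).

Definition prod_pair (B : model E) (h : forall i, alg_hom B (A i)) :
  alg_hom B prod_model.
Proof.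
exists (fun x i => h i x) => n o a.
by apply: functional_extensionality_dep => i; exact: alg_funP.
Defined.

End Product.

(** The limit is the subalgebra of compatible families.  A family is indexed by
    numbers below the number of objects of [J], and not by the objects of [J],
    which may live in a larger universe than the algebras. *)
Lemma variety_finite_limits : has_finite_limits (variety E).
Proof.
move=> J [[n /card_set_bijP [f bijf]] _] D.
pose I : Set := {k : nat | (k < n)%N}.
have e_ex (k : I) : exists j, f j = sval k.
  have [_ _ surf] := bijf.
  by have [j _ fj] := surf (sval k) (svalP k); exists j.
pose e k := sval (cid (e_ex k)).
have fe k : f (e k) = sval k by exact: svalP (cid (e_ex k)).
have f_lt j : (f j < n)%N by have [fJ _ _] := bijf; exact: fJ.
pose g j : I := exist _ (f j) (f_lt j).
have eg j : e (g j) = j.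
  by have [_ injf _] := bijf; apply: injf; rewrite ?in_setT // fe.
(* [e (g j)] and [j] are equal but not convertible: an isomorphism between them
   replaces transport of elements along this equality. *)
have iso j : {t : hom (e (g j)) j & {r | t ∘ r = idm j}}.
  by move: (e (g j)) (eg j) => _ ->; exists (idm j), (idm j); exact: comp_idl.
pose into j := tag (iso j).
pose back j : hom j (e (g j)) := sval (tagged (iso j)).
have into_back j : into j ∘ back j = idm j by exact: svalP (tagged (iso j)).
pose A k : model E := D (e k).
pose act i j (u : hom i j) : alg_hom (D i) (D j) := fmap D u.
have actM i j k (v : hom j k) (u : hom i j) x :
    act _ _ (v ∘ u) x = act _ _ v (act _ _ u x).
  by rewrite /act fmap_comp.
pose compat (x : prod_model A) :=
  forall i k (u : hom (e i) (e k)), act _ _ u (x i) = x k.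
have sub_compat : subalgebra compat.
  move=> m o a ca i k u; rewrite alg_funP /=; congr op.
  by apply: funext => r; exact: ca.
pose K := sub_model sub_compat.
pose leg_fun j : alg_hom K (D j) :=
  alg_comp (act _ _ (into j))
    (alg_comp (prod_proj A (g j)) (sub_incl sub_compat)).
have legE j (x : K) : leg_fun j x = act _ _ (into j) (sval x (g j)) by [].
have leg_nat i j (u : hom i j) : fmap D u ∘ (leg_fun i : hom K _) = leg_fun j.
  apply: alg_hom_eq => x; rewrite [LHS]/= -/(act _ _ u) !legE -!actM.
  rewrite -(svalP x _ _ (back j ∘ (u ∘ into i))) -actM.
  by rewrite !comp_assoc into_back comp_idl.
have legeK k (x : K) : leg_fun (e k) x = sval x k by rewrite legE (svalP x).
exists (@Cone J (variety E) D K leg_fun leg_nat) => L.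
pose L_fun j : alg_hom (apex L) (D j) := leg L j.
have L_nat i j (u : hom i j) x : act _ _ u (L_fun i x) = L_fun j x.
  by rewrite /L_fun -(leg_natural L u).
pose h := sub_lift sub_compat (B := apex L)
  (h := @prod_pair _ A (apex L) (fun k => L_fun (e k)))
  (fun x i k u => L_nat _ _ u x).
exists h; split=> [j|k kl]; apply: alg_hom_eq => x.
  by rewrite [LHS]legE; exact: L_nat.
apply: sub_inj; apply: functional_extensionality_dep => i.
have := congr1 (fun t : alg_hom _ _ => t x) (kl (e i)).
by rewrite [LHS]legeK => ->.
Qed.

(** * Elements of pullbacks, and jointly strongly epic pairs *)

(** An arbitrary pullback is compared with the algebra of matching pairs, which
    gives a description of its elements. *)
Section PullbackElements.
Variables (X Y Z : variety E) (f : hom X Z) (g : hom Y Z) (Q : pullback f g).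

Let fam (b : bool) : model E := if b then X else Y.
Let f' : alg_hom X Z := f.
Let g' : alg_hom Y Z := g.
Let q1 : alg_hom (pb Q) X := pb1 Q.
Let q2 : alg_hom (pb Q) Y := pb2 Q.

Let matching (x : prod_model fam) : Prop := f' (x true) = g' (x false).

Let matching_sub : subalgebra matching.
Proof.
move=> n o a Ma; rewrite /matching (alg_funP f') (alg_funP g'); congr op.
by apply: funext => i; exact: Ma.
Qed.

Let pairs : variety E := sub_model matching_sub.
Let p1 : hom pairs X := alg_comp (prod_proj fam true) (sub_incl matching_sub).
Let p2 : hom pairs Y := alg_comp (prod_proj fam false) (sub_incl matching_sub).

Let p12 : f ∘ p1 = g ∘ p2.
Proof. by apply: alg_hom_eq => x; exact: (svalP x). Qed.

Let q_comm x : f' (q1 x) = g' (q2 x).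
Proof. exact: (congr1 (fun h : alg_hom _ _ => h x) (pb_comm Q)). Qed.

Lemma pullback_point (x : X) (y : Y) : f' x = g' y ->
  exists z : pb Q, q1 z = x /\ q2 z = y.
Proof.
move=> fxy.
pose xy : pairs :=
  exist matching
    (fun b => match b return fam b with true => x | false => y end) fxy.
exists ((pb_pair Q p12 : alg_hom _ _) xy); split.
- exact: (congr1 (fun h : alg_hom _ _ => h xy) (pb_pair1 Q p12)).
- exact: (congr1 (fun h : alg_hom _ _ => h xy) (pb_pair2 Q p12)).
Qed.

Lemma pullback_inj (z t : pb Q) : q1 z = q1 t -> q2 z = q2 t -> z = t.
Proof.
pose h : hom (pb Q) pairs := sub_lift matching_sub (B := pb Q)
  (h := prod_pair (A := fam) (fun b : bool =>
     match b return alg_hom (pb Q) (fam b) with true => q1 | false => q2 end))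
  q_comm.
have hK : pb_pair Q p12 ∘ h = idm (pb Q).
  apply: pb_uniq; rewrite comp_assoc ?pb_pair1 ?pb_pair2; exact: alg_hom_eq.
move=> e1 e2; rewrite -[z]/((idm (pb Q) : alg_hom _ _) z).
rewrite -[t]/((idm (pb Q) : alg_hom _ _) t) -hK.
congr ((pb_pair Q p12 : alg_hom _ _) _); apply: sub_inj.
by apply: functional_extensionality_dep => -[].
Qed.

End PullbackElements.

(** If [m x = m y], then [(x, y)] is an element of the kernel pair of [m], whose
    two projections agree. *)
Lemma monic_inj (M N : variety E) (m : alg_hom M N) :
  monic (m : hom M N) -> injective m.
Proof.
move=> mono_m x y mxy.
have [P] := has_finite_limits_pullbacks variety_finite_limits.
have [z [<- <-]] := pullback_point (P _ _ _ _ _) mxy.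
by rewrite (mono_m _ _ _ (pb_comm _)).
Qed.

Definition generating (A B D : algebra S) (u : alg_hom A D) (v : alg_hom B D) :
    Prop :=
  forall P : D -> Prop, subalgebra P ->
    (forall a, P (u a)) -> (forall b, P (v b)) -> forall d, P d.

Section GeneratingPoints.
Variables (X : variety E) (A B D : Pt X) (u : hom A D) (v : hom B D).

Let uf : alg_hom (pt_obj A) (pt_obj D) := pt_map u.
Let vf : alg_hom (pt_obj B) (pt_obj D) := pt_map v.

(** A subalgebra containing the image of [u] contains the section of [D], hence
    is a subobject of [D] in the category of points. *)
Lemma jointly_strongly_epic_generating :
  jointly_strongly_epic u v -> generating uf vf.
Proof.
move=> uv P subP Pu Pv d.
pose T := sub_model subP; pose i : hom T (pt_obj D) := sub_incl subP.
pose s : hom X T :=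
  sub_lift subP (B := X) (h := pt_map u ∘ pt_s A) (fun x => Pu _).
have is_ : i ∘ s = pt_s D.
  rewrite -(pt_map_s u); exact: alg_hom_eq.
have ps : (pt_p D ∘ i) ∘ s = idm X by rewrite -comp_assoc is_ pt_ps.
pose TP : Pt X := Point ps.
pose m : hom TP D := @PointHom _ X TP D i erefl is_.
have mono_m : monic m.
  move=> W a b ab; apply: point_hom_eq.
  apply: (sub_incl_monic (subP := subP)); exact: (congr1 (@pt_map _ _ _ _) ab).
have lift (G : Pt X) (w : hom G D)
    (Pw : forall a, P ((pt_map w : alg_hom _ _) a)) :
    exists w' : hom G TP, w = m ∘ w'.
  pose h : hom (pt_obj G) T := sub_lift subP (B := pt_obj G) (h := pt_map w) Pw.
  have ih : i ∘ h = pt_map w by exact: alg_hom_eq.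
  have hp : pt_p TP ∘ h = pt_p G by rewrite -comp_assoc ih pt_map_p.
  have hs : h ∘ pt_s G = pt_s TP.
    apply: (sub_incl_monic (subP := subP)).
    by rewrite comp_assoc -/i ih pt_map_s is_.
  by exists (PointHom hp hs); apply: point_hom_eq.
have [u' uE] := lift A u Pu; have [v' vE] := lift B v Pv.
have [||psi [mpsi _]] := uv TP D m mono_m (idm D) u' v'.
- by rewrite comp_idl.
- by rewrite comp_idl.
have := congr1 (fun h : hom D D => (pt_map h : alg_hom _ _) d) mpsi.
by rewrite [X in _ = X]/= => <-; exact: svalP.
Qed.

(** The elements that [phi] maps into the image of the monomorphism [m] form a
    subalgebra; when it is everything, [phi] lifts along [m]. *)
Lemma generating_jointly_strongly_epic :
  generating uf vf -> jointly_strongly_epic u v.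
Proof.
move=> gen M N m mono_m phi u' v' uE vE.
have [P] := has_finite_limits_pullbacks variety_finite_limits.
pose mf : alg_hom (pt_obj M) (pt_obj N) := pt_map m.
pose phif : alg_hom (pt_obj D) (pt_obj N) := pt_map phi.
have inj_m : injective mf by apply: monic_inj; exact: point_monic.
have im_phi d : exists x, mf x = phif d.
  apply: (gen (fun d => exists x, mf x = phif d)) => [n o a /choice [b mb]|a|b].
  - exists (op o b); rewrite !alg_funP; congr op; exact: funext.
  - exists ((pt_map u' : alg_hom _ _) a).
    exact: (congr1 (fun h : hom A N => (pt_map h : alg_hom _ _) a) (esym uE)).
  - exists ((pt_map v' : alg_hom _ _) b).
    exact: (congr1 (fun h : hom B N => (pt_map h : alg_hom _ _) b) (esym vE)).
have [h mh] := choice im_phi.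
have h_op n (o : S n) a : h (op o a) = op o (fun i => h (a i)).
  apply: inj_m; rewrite mh !alg_funP; congr op; apply: funext => i.
  by rewrite mh.
pose hf : hom (pt_obj D) (pt_obj M) := AlgHom h_op.
have mhf : pt_map m ∘ hf = pt_map phi by exact: alg_hom_eq.
have hp : pt_p M ∘ hf = pt_p D.
  by rewrite -(pt_map_p m) -comp_assoc mhf pt_map_p.
have hs : hf ∘ pt_s D = pt_s M.
  by apply: (point_monic P mono_m); rewrite comp_assoc mhf !pt_map_s.
exists (PointHom hp hs); split=> [|k mk]; first exact: point_hom_eq.
by apply: mono_m; rewrite mk; exact: point_hom_eq.
Qed.

End GeneratingPoints.

End Varieties.

(** * Arithmetic in a category of interest *)

Section Interest.
Variables (S : signature) (E : identities S).
Variables (zero : S 0) (neg : S 1) (plus : S 2).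
Hypothesis interest : interest_axioms E zero neg plus.

Definition ap0 (A : algebra S) : A :=
  op zero (fun i : 'I_0 => False_rect _ (notF (ltn_ord i))).
Definition ap1 (A : algebra S) (o : S 1) (x : A) : A := op o (fun=> x).
Definition ap2 (A : algebra S) (o : S 2) (x y : A) : A :=
  op o (fun i : 'I_2 => if i == ord0 then x else y).

Local Notation "0" := (ap0 _).
Local Notation "⊖ x" := (ap1 neg x) (at level 35, right associativity).
Local Notation "x ⊕ y" := (ap2 plus x y) (at level 50, left associativity).
Local Notation un w x := (ap1 (sval w) x).
Local Notation bin b x y := (ap2 (sval b) x y).
Local Notation unary := (unary' neg).
Local Notation binary := (binary' plus).

Section Homomorphisms.
Variables (A B : algebra S) (h : alg_hom A B).

Lemma hom_ap0 : h 0 = 0.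
Proof. by rewrite alg_funP; congr op; apply: funext => -[]. Qed.

Lemma hom_ap1 o x : h (ap1 o x) = ap1 o (h x).
Proof. exact: alg_funP. Qed.

Lemma hom_ap2 o x y : h (ap2 o x y) = ap2 o (h x) (h y).
Proof. by rewrite alg_funP; congr op; apply: funext => i; case: eqP. Qed.

End Homomorphisms.

Section Evaluation.
Variables (A : algebra S) (V : Type) (v : V -> A).

Lemma eval_op0 : eval v (op0 V zero) = 0.
Proof. by congr op; apply: funext => -[]. Qed.

Lemma eval_op1 o t : eval v (op1 o t) = ap1 o (eval v t).
Proof. by []. Qed.

Lemma eval_op2 o s t : eval v (op2 o s t) = ap2 o (eval v s) (eval v t).
Proof. by congr op; apply: funext => i; case: eqP. Qed.

Lemma eval_subst (W : Type) (f : W -> term S V) (t : term S W) :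
  eval v (subst f t) = eval (fun w => eval v (f w)) t.
Proof.
by elim: t => [w|n o a IHa] //=; congr op; apply: funext => i; exact: IHa.
Qed.

End Evaluation.

Lemma interest_subalgebra (A : algebra S) (P : A -> Prop) :
  P 0 -> (forall x, P x -> P (⊖ x)) ->
  (forall x y, P x -> P y -> P (x ⊕ y)) ->
  (forall (w : unary) x, P x -> P (un w x)) ->
  (forall (b : binary) x y, P x -> P y -> P (bin b x y)) ->
  subalgebra P.
Proof.
move=> P0 PN PD P1 P2 [|[|[|n]]] o a Pa.
- rewrite (int_zero interest o).
  have -> // : a = fun i => False_rect _ (notF (ltn_ord i)).
  by apply: funext => -[].
- have -> : a = fun=> a ord0 by apply: funext => i; rewrite (ord1 i).
  have [->|neq_o] := pselect (o = neg); first exact: PN.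
  exact: (P1 (exist _ o neq_o)).
- have -> : a = fun i => if i == ord0 then a ord0 else a ord_max.
    apply: funext => i; case: eqP => [->//|/eqP i0]; congr a.
    by apply: val_inj; case: i i0 => -[|[|]].
  have [->|neq_o] := pselect (o = plus); first exact: PD.
  exact: (P2 (exist _ o neq_o)).
- by case: (int_arity interest _ o).
Qed.

Section Arithmetic.
Variable A : model E.
Implicit Types x y z : A.

Lemma holds (s t : term S nat) x y z : includes E s t ->
  eval (nth z [:: x; y]) s = eval (nth z [:: x; y]) t.
Proof. by apply; exact: modelP. Qed.

Let evalE := (eval_op0, eval_op2, eval_op1).

Lemma addA x y z : x ⊕ (y ⊕ z) = x ⊕ y ⊕ z.
Proof. by have := holds x y z (int_addA interest); rewrite !evalE. Qed.

Lemma add0 x : 0 ⊕ x = x.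
Proof. by have := holds x x x (int_add0x interest); rewrite !evalE. Qed.

Lemma addx0 x : x ⊕ 0 = x.
Proof. by have := holds x x x (int_addx0 interest); rewrite !evalE. Qed.

Lemma addNx x : ⊖ x ⊕ x = 0.
Proof. by have := holds x x x (int_addNx interest); rewrite !evalE. Qed.

Lemma addxN x : x ⊕ ⊖ x = 0.
Proof. by have := holds x x x (int_addxN interest); rewrite !evalE. Qed.

Lemma unD (w : unary) x y : un w (x ⊕ y) = un w x ⊕ un w y.
Proof. by have := holds x y x (int_unD interest w); rewrite !evalE. Qed.

Lemma binDr (b : binary) x y z : bin b x (y ⊕ z) = bin b x y ⊕ bin b x z.
Proof. by have := holds x y z (int_binD interest b); rewrite !evalE. Qed.

Lemma un_bin (w : unary) (b : binary) x y : bin b (un w x) y = un w (bin b x y).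
Proof. by have := holds x y x (int_un_bin interest w b); rewrite !evalE. Qed.

Lemma bin_central (b : binary) x y z : x ⊕ bin b y z = bin b y z ⊕ x.
Proof.
by have := holds x y z (int_bin_central interest b); rewrite !evalE.
Qed.

Lemma bin_op (b : binary) :
  exists b' : binary, forall x y, bin b' x y = bin b y x.
Proof.
have [b' bb'] := int_op interest b; exists b' => x y.
by have := holds x y x bb'; rewrite !evalE.
Qed.

(** The form in which the word axiom is used: a word stays in every subalgebra
    that contains its arguments. *)
Lemma bin_word (P : A -> Prop) (b c : binary) x y z :
  subalgebra P ->
  (forall b' c' : binary, P (bin b' x (bin c' y z))) ->
  (forall b' c' : binary, P (bin b' y (bin c' x z))) ->
  P (bin c (bin b x y) z).
Proof.
move=> subP Px Py; have [m [n [w [b_ [c_ [_ id_w]]]]]] := int_word interest b c.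
have := holds x y z id_w; rewrite eval_subst !evalE => ->.
by apply: subalgebra_eval => // i; case: ifP => _; rewrite !evalE.
Qed.

Lemma addKx x y : ⊖ x ⊕ (x ⊕ y) = y.
Proof. by rewrite addA addNx add0. Qed.

Lemma addxNK x y : x ⊕ ⊖ y ⊕ y = x.
Proof. by rewrite -addA addNx addx0. Qed.

Lemma addxK x y : x ⊕ y ⊕ ⊖ y = x.
Proof. by rewrite -addA addxN addx0. Qed.

Lemma add_eq0 x y : x ⊕ y = 0 -> ⊖ x = y.
Proof. by move=> xy; rewrite -[RHS](addKx x) xy addx0. Qed.

Lemma oppD x y : ⊖ (x ⊕ y) = ⊖ y ⊕ ⊖ x.
Proof. by apply: add_eq0; rewrite addA addxK addxN. Qed.

Lemma additive0 (f : A -> A) : {morph f : x y / x ⊕ y} -> f 0 = 0.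
Proof. by move=> fD; rewrite -(addKx (f 0) (f 0)) -fD addx0 addNx. Qed.

Lemma additiveN (f : A -> A) : {morph f : x y / x ⊕ y} -> {morph f : x / ⊖ x}.
Proof.
by move=> fD x; apply/esym/add_eq0; rewrite -fD addxN; exact: additive0.
Qed.

Lemma binDl (b : binary) y : {morph (fun x => bin b x y) : x x' / x ⊕ x'}.
Proof. by move=> x x'; have [b' bE] := bin_op b; rewrite -!bE binDr. Qed.

Definition conj y x := y ⊕ x ⊕ ⊖ y.

Lemma conjD y : {morph conj y : x x' / x ⊕ x'}.
Proof. by move=> x x'; rewrite /conj !addA addxNK. Qed.

Lemma conj_bin (b : binary) y x x' : conj y (bin b x x') = bin b x x'.
Proof. by rewrite /conj bin_central addxK. Qed.

Lemma zero_subalgebra : subalgebra (eq (0 : A)).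
Proof.
apply: interest_subalgebra => // [_ <-|_ _ <- <-|w _ <-|b _ _ <- <-].
- exact/esym/add_eq0/add0.
- by rewrite add0.
- exact/esym/additive0/unD.
- exact/esym/additive0/binDr.
Qed.

(** * The kernel of a point *)

(** The unary operations other than minus are left out on purpose: conjugation
    does not commute with them, and an induction over terms containing them
    would break down in [span_conj]. *)
Inductive span (G : A -> Prop) : A -> Prop :=
| span_gen x of G x : span G x
| span0 : span G 0
| spanN x of span G x : span G (⊖ x)
| spanD x y of span G x & span G y : span G (x ⊕ y)
| spanM (b : binary) x y of span G x & span G y : span G (bin b x y).

Lemma span_sub (G P : A -> Prop) :
  subalgebra P -> (forall x, G x -> P x) -> forall x, span G x -> P x.
Proof.
move=> subP GP x; elim=> {x} [x Gx||x _ Px|x y _ Px _ Py|b x y _ Px _ Py];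
  first exact: GP.
all: by apply: subP => -[m lt_m] //; case: ifP.
Qed.

(** Additivity moves a unary operation through sums, and [un_bin] moves it into
    the first factor of a product, so it need only be applied to [G]. *)
Lemma span_subalgebra (G : A -> Prop) :
  (forall (w : unary) x, G x -> G (un w x)) -> subalgebra (span G).
Proof.
move=> Gun; apply: interest_subalgebra; [exact: span0 | exact: spanN
  | exact: spanD | | exact: spanM].
move=> w x; elim=> {x} [x Gx||x _ Lx|x y _ Lx _ Ly|b x y _ Lx Ly _].
- by apply: span_gen; exact: Gun.
- rewrite (additive0 (f := fun x => un _ x) (unD w)); exact: span0.
- by rewrite (additiveN (f := fun x => un _ x) (unD w)); exact: spanN.
- by rewrite unD; exact: spanD.
- by rewrite -un_bin; exact: spanM.
Qed.

(** In this section [T] plays the part of the base of a point with section [s],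
    and [G] that of a set of elements of its kernel. *)
Section SpanComplement.
Variables (T : algebra S) (s : alg_hom T A) (G : A -> Prop).
Hypothesis G_un : forall (w : unary) x, G x -> G (un w x).
Hypothesis G_conj : forall t x, G x -> G (conj (s t) x).
Hypothesis G_bin : forall (b : binary) t x, G x -> G (bin b x (s t)).

(** Conjugation is additive and fixes products. *)
Lemma span_conj t x : span G x -> span G (conj (s t) x).
Proof.
elim=> {x} [x Gx||x _ Lx|x y _ Lx _ Ly|b x y Lx _ Ly _].
- by apply: span_gen; exact: G_conj.
- rewrite (additive0 (conjD _)); exact: span0.
- by rewrite (additiveN (conjD _)); exact: spanN.
- by rewrite conjD; exact: spanD.
- by rewrite conj_bin; exact: spanM.
Qed.

(** The statement is proved for all [b] at once, since [bin_word] replaces the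
    outer operation [b] by other operations. *)
Lemma span_bin (b : binary) t x : span G x -> span G (bin b x (s t)).
Proof.
move=> Lx; elim: Lx b => {x} [x Gx||x _ Lx|x y _ Lx _ Ly|c x y Lx LxT Ly LyT] b.
- by apply: span_gen; exact: G_bin.
- rewrite (additive0 (binDl b _)); exact: span0.
- by rewrite (additiveN (binDl b _)); exact: spanN.
- by rewrite binDl; exact: spanD.
- by apply: bin_word => [|b' c'|b' c']; [exact: span_subalgebra | |]; exact: spanM.
Qed.

(** Each operation on sums [l + s t] is brought to the same form by conjugating
    elements of the span past elements of the image of [s], and by expanding
    products, whose mixed terms lie in the span. *)
Lemma span_complement_subalgebra :
  subalgebra (fun d : A => exists l t, span G l /\ d = l ⊕ s t).
Proof.
apply: interest_subalgebra.
- by exists 0, 0; rewrite hom_ap0 add0; split=> //; exact: span0.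
- move=> _ [l [t [Ll ->]]]; exists (conj (s (⊖ t)) (⊖ l)), (⊖ t).
  split; first by apply: span_conj; exact: spanN.
  by rewrite /conj addxNK hom_ap1 oppD.
- move=> _ _ [l [t [Ll ->]]] [l' [t' [Ll' ->]]].
  exists (l ⊕ conj (s t) l'), (t ⊕ t'); split.
    by apply: spanD => //; exact: span_conj.
  by rewrite /conj hom_ap2 !addA addxNK.
- move=> w _ [l [t [Ll ->]]]; exists (un w l), (un w t); split.
    exact: span_subalgebra.
  by rewrite hom_ap1 unD.
- move=> b _ _ [l [t [Ll ->]]] [l' [t' [Ll' ->]]]; have [b' bE] := bin_op b.
  exists (bin b l l' ⊕ bin b (s t) l' ⊕ bin b l (s t')), (bin b t t'); split.
    rewrite -[X in _ ⊕ X ⊕ _]bE; apply: spanD; last exact: span_bin.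
    by apply: spanD; [exact: spanM | exact: span_bin].
  by rewrite hom_ap2 binDr !binDl !addA.
Qed.

End SpanComplement.

End Arithmetic.

Section KernelOfPoint.
Variables (Y : variety E) (A B D : Pt Y) (u : hom A D) (v : hom B D).

Let p : alg_hom (pt_obj D) Y := pt_p D.
Let s : alg_hom Y (pt_obj D) := pt_s D.

Definition ker_image (B : Pt Y) (v : hom B D) (k : pt_obj D) : Prop :=
  p k = 0 /\ exists b, (pt_map v : alg_hom _ _) b = k.

Lemma ps y : p (s y) = y.
Proof. exact: (congr1 (fun h : alg_hom _ _ => h y) (pt_ps D)). Qed.

Lemma map_s (G : Pt Y) (w : hom G D) y :
  (pt_map w : alg_hom _ _) ((pt_s G : alg_hom _ _) y) = s y.
Proof. exact: (congr1 (fun h : alg_hom _ _ => h y) (pt_map_s w)). Qed.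

Section Closure.
Variables (G : Pt Y) (w : hom G D).

Lemma ker_image_un (o : unary) k : ker_image w k -> ker_image w (un o k).
Proof.
move=> [pk [a wa]]; split.
  by rewrite hom_ap1 pk (additive0 (f := fun x => un _ x) (unD o)).
by exists (un o a); rewrite hom_ap1 wa.
Qed.

Lemma ker_image_conj y k : ker_image w k -> ker_image w (conj (s y) k).
Proof.
move=> [pk [a wa]]; split.
  by rewrite !hom_ap2 hom_ap1 pk addx0 addxN.
exists (conj ((pt_s G : alg_hom _ _) y) a).
by rewrite !hom_ap2 hom_ap1 wa map_s.
Qed.

Lemma ker_image_bin (b : binary) y k :
  ker_image w k -> ker_image w (bin b k (s y)).
Proof.
move=> [pk [a wa]]; split.
  by rewrite hom_ap2 pk (additive0 (binDl b _)).
exists (bin b a ((pt_s G : alg_hom _ _) y)).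
by rewrite hom_ap2 wa map_s.
Qed.

Lemma image_decomposition a (d := (pt_map w : alg_hom _ _) a) :
  ker_image w (d ⊕ ⊖ s (p d)).
Proof.
split; first by rewrite hom_ap2 hom_ap1 ps addxN.
by exists (a ⊕ ⊖ (pt_s G : alg_hom _ _) (p d)); rewrite hom_ap2 hom_ap1 map_s.
Qed.

End Closure.

(** For [d] in the kernel of [p] the term [s (p d)] vanishes: the kernel is
    spanned by the kernel parts of the images of [u] and [v], without help from
    the image of [s]. *)
Lemma generated_by_kernels :
  generating (pt_map u : alg_hom _ _) (pt_map v : alg_hom _ _) ->
  forall d : pt_obj D, exists2 l,
    span (fun k => ker_image u k \/ ker_image v k) l & d = l ⊕ s (p d).
Proof.
pose G k := ker_image u k \/ ker_image v k; move=> gen.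
have dec d : exists l y, span G l /\ d = l ⊕ s y.
  move: d; apply: gen; [apply: (span_complement_subalgebra (G := G)) | |].
  - by move=> o k [|] Gk; [left | right]; exact: ker_image_un.
  - by move=> y k [|] Gk; [left | right]; exact: ker_image_conj.
  - by move=> b y k [|] Gk; [left | right]; exact: ker_image_bin.
  - move=> a; set d := alg_fun _ a; exists (d ⊕ ⊖ s (p d)), (p d).
    split; last by rewrite addxNK.
    by apply: span_gen; left; exact: image_decomposition.
  - move=> b; set d := alg_fun _ b; exists (d ⊕ ⊖ s (p d)), (p d).
    split; last by rewrite addxNK.
    by apply: span_gen; right; exact: image_decomposition.
move=> d; have [l [y [Gl dE]]] := dec d; exists l => //.
have pl : 0 = p l.
  apply: (@span_sub _ G (fun k => 0 = p k)) Gl; last by move=> k [|] [].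
  move=> n o a pa; rewrite alg_funP; exact: zero_subalgebra.
by rewrite {2}dE hom_ap2 -pl add0 ps.
Qed.

End KernelOfPoint.

(** * Change of base preserves generation *)

(** A subalgebra [T] of [f^* D] containing both images contains [(0, l)] for
    every [l] in the span of the kernel parts, because these [l] form a
    subalgebra of [D], and [(x, s (f x))] for every [x], because this is the
    value of the section. *)
Lemma change_of_base_generating (P : pullback_choice (variety E))
    (X Y : variety E) (f : hom X Y) (A B D : Pt Y) (u : hom A D) (v : hom B D) :
  generating (pt_map u : alg_hom _ _) (pt_map v : alg_hom _ _) ->
  generating (pt_map (cob_hom P f u) : alg_hom _ _)
    (pt_map (cob_hom P f v) : alg_hom _ _).
Proof.
move=> gen T subT Tu Tv z.
pose Q (G : Pt Y) := P _ _ _ f (pt_p G).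
pose q1 G : alg_hom (pb (Q G)) X := pb1 (Q G).
pose q2 G : alg_hom (pb (Q G)) (pt_obj G) := pb2 (Q G).
pose lift_kernel (k : pt_obj D) := exists t, [/\ T t, 0 = q1 D t & q2 D t = k].
have lift_ker_image (G : Pt Y) (w : hom G D) k :
    (forall t, T ((pt_map (cob_hom P f w) : alg_hom _ _) t)) ->
    ker_image w k -> lift_kernel k.
  move=> Tw [pk [a wa]].
  have fpa : (f : alg_hom _ _) 0 = (pt_p G : alg_hom _ _) a.
    by rewrite hom_ap0 -(pt_map_p w) /= wa pk.
  have [t [t1 t2]] := pullback_point (Q G) fpa.
  exists ((cob_map P f w : alg_hom _ _) t); split; first exact: Tw.
    rewrite -t1; apply/esym.
    exact: (congr1 (fun h : alg_hom _ _ => h t)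
      (pb_pair1 _ (cob_map_comm P f w))).
  rewrite -wa -t2.
  exact: (congr1 (fun h : alg_hom _ _ => h t)
    (pb_pair2 _ (cob_map_comm P f w))).
have sub_lift_kernel : subalgebra lift_kernel.
  move=> n o a /choice [t /all_and3 [Tt t1 t2]].
  exists (op o t); split; first exact: subT.
    by rewrite alg_funP; exact: zero_subalgebra.
  by rewrite alg_funP; congr op; exact: funext.
have [l Gl zE] := generated_by_kernels gen (q2 D z).
have [t [Tt t1 t2]] : lift_kernel l.
  apply: span_sub Gl => // k [|]; exact: lift_ker_image.
(* The element [(x, s (f x))] of the pulled back algebra. *)
pose sX : alg_hom X (pb (Q D)) := pt_s (cob_obj P f D).
have TsX x : T (sX x).
  rewrite /sX -(cob_map_s P f u); exact: Tu.
suff -> : z = t ⊕ sX (q1 D z).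
  by apply: subT => i; case: ifP.
apply: pullback_inj.
- rewrite hom_ap2 -t1 add0.
  exact/esym/(congr1 (fun h : alg_hom _ _ => h (q1 D z))
    (pb_pair1 _ (cob_s_comm f D))).
- rewrite hom_ap2 [X in X ⊕ _]t2 [LHS]zE; congr ap2.
  have -> : (pt_p D : alg_hom _ _) (q2 D z) = (f : alg_hom _ _) (q1 D z).
    exact/esym/(congr1 (fun h : alg_hom _ _ => h z) (pb_comm (Q D))).
  exact/esym/(congr1 (fun h : alg_hom _ _ => h (q1 D z))
    (pb_pair2 _ (cob_s_comm f D))).
Qed.

End Interest.

Theorem theorem4p15 (S : signature) (E : identities S)
    (interestE : category_of_interest E) :
  algebraically_coherent (variety E).
Proof.
have [zero [neg [plus interest]]] := interestE.
have limE := variety_finite_limits (E := E).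
split=> // P X Y f; split; [exact: Pt_finite_limits | exact: Pt_finite_limits
  | exact: change_of_base_limits |].
move=> A B D u v /jointly_strongly_epic_generating gen.
apply: generating_jointly_strongly_epic.
exact: (change_of_base_generating interest).
Qed.
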